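(* For all $k\ge0$ the adjunction $H_{k+1}\dashv K_{k+1}$, with $K_{k+1}:\mathbf{Contr}_{k+1}\to\mathbf{Contr}_k$ the functor forgetting the $(k+1)$th dimension of contraction structure, lifts to an adjunction $F_{k+1,k}\dashv G_{k+1,k}$, $$\mathbf{OWC}_{k+1,k}\ \underset{F_{k+1,k}}{\overset{G_{k+1,k}}{\rightleftarrows}}\ \mathbf{OWC}_{k,k},$$ where $G_{k+1,k}$ is the functor forgetting the $(k+1)$th dimension of contraction structure, such that the following diagram serially commutes: writing $U:\mathbf{OWC}_{k+1,k}\to\mathbf{Contr}_{k+1}$ and $U':\mathbf{OWC}_{k,k}\to\mathbf{Contr}_k$ for the functors forgetting the operad structure, $$U'\,G_{k+1,k}=K_{k+1}\,U\qquad\text{and}\qquad U\,F_{k+1,k}=H_{k+1}\,U'.$$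
   Context: A globular set $A$ consists of sets $A_k$ ($k\ge 0$) of $k$-cells and maps $s,t:A_{k}\to A_{k-1}$ ($k\ge1$) with $ss=st$ and $ts=tt$; morphisms commute with $s$ and $t$. The category is $\mathbf{GSet}$. Let $T$ be the free strict $\omega$-category monad on $\mathbf{GSet}$, with unit $\eta$ and multiplication $\mu$, and $1$ the terminal globular set. The category $\mathbf{Coll}$ of collections is $\mathbf{GSet}/T1$. It is monoidal: the tensor product of $d:A\to T1$ and $d':A'\to T1$ is the pullback $A\otimes A'$ of $d:A\to T1$ along $T!:TA'\to T1$, with structure map $A\otimes A'\to TA'\xrightarrow{Td'}T^21\xrightarrow{\mu_1}T1$; the unit is $\eta_1:1\to T1$. A (globular) operad is a monoid in $\mathbf{Coll}$. Two $k$-cells $a,b$ are parallel if $k=0$, or $k\ge1$ and $sa=sb$, $ta=tb$. A contraction $\gamma$ on a collection $d:A\to T1$ assigns, for every $k\ge0$, to every parallel pair $a,b\in A_k$ and every $(k+1)$-cell $\theta:da\to db$ of $T1$, a $(k+1)$-cell $\gamma_\theta(a,b):a\to b$ of $A$ with $d(\gamma_\theta(a,b))=\theta$. Morphisms preserving contractions satisfy $f(\gamma_\theta(a,b))=\gamma'_\theta(fa,fb)$. The underlying $k$-collection of a collection is obtained by discarding all cells of dimension $>k$. Since the cells of dimension $\le k$ of $A\otimes A'$ depend only on the cells of dimension $\le k$ of $A$ and $A'$, $k$-collections inherit a truncated monoidal structure; a $k$-operad is a monoid for it. A $k$-contraction is contraction data restricted to parallel pairs of $m$-cells with $0\le m\le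 k-1$ (so contraction cells have dimension at most $k$). $\mathbf{Contr}_k$ is the category of (full, not truncated) collections whose underlying $k$-collection is equipped with a $k$-contraction. $\mathbf{OWC}_{i,j}$ ($i,j\ge0$) is the category of (full) collections whose underlying $i$-collection is equipped with an $i$-contraction and whose underlying $j$-collection is equipped with the structure of a $j$-operad, with no compatibility axioms between the two. In each case morphisms are morphisms of collections preserving all the structure present. In particular $\mathbf{Contr}_0=\mathbf{Coll}$. $H_{k+1}:\mathbf{Contr}_k\to\mathbf{Contr}_{k+1}$ is the left adjoint of $K_{k+1}$, chosen so that it leaves all dimensions of the underlying collection unchanged except dimension $k+1$ and preserves the underlying $k$-contraction structure. *)

(* Defs.v *)
From mathcomp Require Import all_boot boolp.

Set Implicit Arguments.
Unset Strict Implicit.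
Unset Printing Implicit Defensive.

Lemma sig_ext (X : Type) (P : X -> Prop) (u v : {x | P x}) :
  proj1_sig u = proj1_sig v -> u = v.
Proof. by case: u v => [x p] [y q]; exact: eq_exist. Qed.

Record category := Category {
  ob :> Type;
  hom : ob -> ob -> Type;
  idm : forall X, hom X X;
  cmp : forall X Y Z, hom Y Z -> hom X Y -> hom X Z;
  cmp_idl : forall X Y (f : hom X Y), cmp (idm Y) f = f;
  cmp_idr : forall X Y (f : hom X Y), cmp f (idm X) = f;
  cmpA : forall X Y Z W (h : hom Z W) (g : hom Y Z) (f : hom X Y),
    cmp h (cmp g f) = cmp (cmp h g) f }.
Arguments hom {c}.
Arguments idm {c}.
Arguments cmp {c X Y Z}.

Record functor (C D : category) := Functor {
  fob :> C -> D;
  fmap : forall X Y, hom X Y -> hom (fob X) (fob Y);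
  fmap_id : forall X, fmap (idm X) = idm (fob X);
  fmap_cmp : forall X Y Z (g : hom Y Z) (f : hom X Y),
    fmap (cmp g f) = cmp (fmap g) (fmap f) }.
Arguments fmap {C D} _ {X Y}.

Section FunctorComposition.
Context {C D E : category} (G : functor D E) (F : functor C D).

Lemma fcomp_id (X : C) : fmap G (fmap F (idm X)) = idm (G (F X)).
Proof. by rewrite !fmap_id. Qed.

Lemma fcomp_cmp (X Y Z : C) (g : hom Y Z) (f : hom X Y) :
  fmap G (fmap F (cmp g f)) = cmp (fmap G (fmap F g)) (fmap G (fmap F f)).
Proof. by rewrite !fmap_cmp. Qed.

Definition fcomp : functor C E :=
  @Functor C E (fun X => G (F X)) (fun X Y f => fmap G (fmap F f))
    fcomp_id fcomp_cmp.
End FunctorComposition.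

Record adjunction (C D : category) (L : functor C D) (R : functor D C) :=
  Adjunction {
  unit : forall X : C, hom X (R (L X));
  counit : forall Y : D, hom (L (R Y)) Y;
  unit_nat : forall X Y (f : hom X Y),
    cmp (unit Y) f = cmp (fmap R (fmap L f)) (unit X);
  counit_nat : forall X Y (g : hom X Y),
    cmp (counit Y) (fmap L (fmap R g)) = cmp g (counit X);
  triangleL : forall X, cmp (counit (L X)) (fmap L (unit X)) = idm (L X);
  triangleR : forall Y, cmp (fmap R (counit Y)) (unit (R Y)) = idm (R Y) }.
Arguments unit {C D L R} _ X.
Arguments counit {C D L R} _ Y.

Record gset := GSet {
  cells :> nat -> Type;
  src : forall n, cells n.+1 -> cells n;
  tgt : forall n, cells n.+1 -> cells n;
  src_tgt : forall n (x : cells n.+2), src (src x) = src (tgt x);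
  tgt_src : forall n (x : cells n.+2), tgt (src x) = tgt (tgt x) }.
Arguments src {g n}.
Arguments tgt {g n}.

Record ghom (A B : gset) := GHom {
  gmap :> forall n, A n -> B n;
  gmap_src : forall n (x : A n.+1), gmap (src x) = src (gmap x);
  gmap_tgt : forall n (x : A n.+1), gmap (tgt x) = tgt (gmap x) }.
Arguments gmap {A B} _ {n}.

Lemma ghom_ext (A B : gset) (f g : ghom A B) :
  (forall n (x : A n), f _ x = g _ x) -> f = g.
Proof.
case: f g => [f fs ft] [g gs gt] /= fg.
have e : f = g by apply: functional_extensionality_dep => n; apply: funext.
by case: _ / e in gs gt *; congr GHom.
Qed.

Definition gid (A : gset) : ghom A A :=
  @GHom A A (fun _ x => x) (fun _ _ => erefl) (fun _ _ => erefl).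

Section GComp.
Context {A B C : gset} (g : ghom B C) (f : ghom A B).
Fact gcomp_src n (x : A n.+1) : g _ (f _ (src x)) = src (g _ (f _ x)).
Proof. by rewrite !gmap_src. Qed.
Fact gcomp_tgt n (x : A n.+1) : g _ (f _ (tgt x)) = tgt (g _ (f _ x)).
Proof. by rewrite !gmap_tgt. Qed.
Definition gcomp : ghom A C :=
  @GHom A C (fun n x => g n (f n x)) gcomp_src gcomp_tgt.
End GComp.

Definition gone : gset :=
  @GSet (fun _ => Datatypes.unit) (fun _ x => x) (fun _ x => x)
    (fun _ _ => erefl) (fun _ _ => erefl).

Definition gbang (A : gset) : ghom A gone :=
  @GHom A gone (fun _ _ => tt) (fun _ _ => erefl) (fun _ _ => erefl).

Lemma gone_uniq (A : gset) (f g : ghom A gone) : f = g.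
Proof. by apply: ghom_ext => n x; case: (f n x); case: (g n x). Qed.

Definition parallel (A : gset) n : A n -> A n -> Prop :=
  match n with
  | 0 => fun _ _ => True
  | _.+1 => fun a b => src a = src b /\ tgt a = tgt b
  end.

(* [glue p x y] says that p < n and that the p-dimensional source of [x] is
   the p-dimensional target of [y], i.e. that the composite of [x] after [y]
   along p-cells is defined. *)
Fixpoint glue (A : gset) (p n : nat) : A n -> A n -> Prop :=
  match n with
  | 0 => fun _ _ => False
  | m.+1 => fun x y =>
      if p == m then src x = tgt y else glue p (src x) (tgt y)
  end.

(* For x : A n and p < n, [idsrc i p x] (resp. [idtgt i p x]) is the n-cell
   obtained from the p-dimensional source (resp. target) of [x] by applying
   the identity operation n - p times; the value is irrelevant for p >= n. *)
Section IteratedIdentities.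
Variables (A : gset) (i : forall n, A n -> A n.+1).
Fixpoint idsrc (p n : nat) : A n -> A n :=
  match n with
  | 0 => id
  | m.+1 => fun x => i (if p == m then src x else idsrc p (src x))
  end.
Fixpoint idtgt (p n : nat) : A n -> A n :=
  match n with
  | 0 => id
  | m.+1 => fun x => i (if p == m then tgt x else idtgt p (tgt x))
  end.
End IteratedIdentities.

(* In each axiom the composability proofs are quantified over independently;
   those of the composites on the right-hand sides follow from the others. *)
Record ocat := OCat {
  ocarrier :> gset;
  oid : forall n, ocarrier n -> ocarrier n.+1;
  ocomp : forall p n (x y : ocarrier n), glue p x y -> ocarrier n;
  src_oid : forall n (x : ocarrier n), src (oid x) = x;
  tgt_oid : forall n (x : ocarrier n), tgt (oid x) = x;
  src_ocomp_top : forall n (x y : ocarrier n.+1) (h : glue n x y),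
    src (ocomp h) = src y;
  tgt_ocomp_top : forall n (x y : ocarrier n.+1) (h : glue n x y),
    tgt (ocomp h) = tgt x;
  src_ocomp : forall p n (x y : ocarrier n.+1)
      (h : glue p x y) (h' : glue p (src x) (src y)),
    src (ocomp h) = ocomp h';
  tgt_ocomp : forall p n (x y : ocarrier n.+1)
      (h : glue p x y) (h' : glue p (tgt x) (tgt y)),
    tgt (ocomp h) = ocomp h';
  ocompA : forall p n (x y z : ocarrier n)
      (hxy : glue p x y) (hyz : glue p y z)
      (hl : glue p (ocomp hxy) z) (hr : glue p x (ocomp hyz)),
    ocomp hl = ocomp hr;
  ocomp_idr : forall p n (x : ocarrier n) (h : glue p x (idsrc oid p x)),
    ocomp h = x;
  ocomp_idl : forall p n (x : ocarrier n) (h : glue p (idtgt oid p x) x),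
    ocomp h = x;
  ocomp_oid : forall p n (x y : ocarrier n)
      (h : glue p x y) (h' : glue p (oid x) (oid y)),
    ocomp h' = oid (ocomp h);
  interchange : forall q p n (x' x y' y : ocarrier n), q < p ->
    forall (hx : glue p x' x) (hy : glue p y' y)
      (hxy : glue q (ocomp hx) (ocomp hy))
      (hl : glue q x' y') (hr : glue q x y)
      (hlr : glue p (ocomp hl) (ocomp hr)),
    ocomp hxy = ocomp hlr }.
Arguments oid {o n}.
Arguments ocomp {o p n x y}.

Record ofunctor (C D : ocat) := OFunctor {
  ofmap :> ghom C D;
  ofmap_oid : forall n (x : C n), ofmap _ (oid x) = oid (ofmap _ x);
  ofmap_ocomp : forall p n (x y : C n) (h : glue p x y)
      (h' : glue p (ofmap _ x) (ofmap _ y)),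
    ofmap _ (ocomp h) = ocomp h' }.

Lemma ofunctor_ext (C D : ocat) (f g : ofunctor C D) :
  (forall n (x : C n), f _ x = g _ x) -> f = g.
Proof.
case: f g => [f fi fc] [g gi gc] /= /ghom_ext fg.
by case: _ / fg in gi gc *; congr OFunctor.
Qed.

Arguments ofmap_oid {C D} _ {n}.
Arguments ofmap_ocomp {C D} _ {p n x y} h h'.

Definition ofid (C : ocat) : ofunctor C C.
Proof.
apply: (@OFunctor C C (gid C)) => // p n x y h h' /=.
by rewrite (Prop_irrelevance h h').
Defined.

Lemma glue_map (A B : gset) (f : ghom A B) p n (x y : A n) :
  glue p x y -> glue p (f _ x) (f _ y).
Proof.
elim: n x y => //= n IH x y; case: eqP => _.
  by rewrite -gmap_src -gmap_tgt => ->.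
by rewrite -gmap_src -gmap_tgt => /IH.
Qed.

Definition ofcomp (C D E : ocat) (g : ofunctor D E) (f : ofunctor C D) :
  ofunctor C E.
Proof.
apply: (@OFunctor C E (gcomp g f)) => [n x|p n x y h h'] /=.
  by rewrite !ofmap_oid.
by rewrite (ofmap_ocomp f h (glue_map f h)) (ofmap_ocomp g _ h').
Defined.

Record free_ocat (A : gset) := FreeOCat {
  fr_cat : ocat;
  fr_unit : ghom A fr_cat;
  fr_ext : forall C : ocat, ghom A C -> ofunctor fr_cat C;
  fr_extE : forall (C : ocat) (f : ghom A C), gcomp (fr_ext f) fr_unit = f;
  fr_uniq : forall (C : ocat) (g h : ofunctor fr_cat C),
    gcomp g fr_unit = gcomp h fr_unit -> g = h }.

(* Existence.  Formal terms are evaluated in all strict omega-categories [C]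
   under all maps [A -> C]; the n-cells are the terms whose value is always
   defined, two terms being identified when their values always agree. *)
Section FreeExistence.
Variable A : gset.

Inductive term : nat -> Type :=
| Gen n of A n : term n
| Src n of term n.+1 : term n
| Tgt n of term n.+1 : term n
| Idt n of term n : term n.+1
| Cmp (p : nat) n of term n & term n : term n.

Definition pcomp (C : ocat) p n (x y : C n) : option (C n) :=
  match pselect (glue p x y) with
  | left h => Some (ocomp h)
  | right _ => None
  end.

Fixpoint ev (C : ocat) (f : ghom A C) n (t : term n) : option (C n) :=
  match t in term n return option (C n) with
  | Gen n a => Some (f n a)
  | Src n t => omap (@src C n) (ev f t)
  | Tgt n t => omap (@tgt C n) (ev f t)
  | Idt n t => omap (@oid C n) (ev f t)
  | Cmp p n t u => obind (fun x => obind (pcomp p x) (ev f u)) (ev f t)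
  end.

Definition good n (t : term n) :=
  forall (C : ocat) (f : ghom A C), exists c, ev f t = Some c.
Definition teq n (t u : term n) : Prop :=
  forall (C : ocat) (f : ghom A C), ev f t = ev f u.

Definition fcell n := {P : term n -> Prop | exists2 t, good t & P = teq t}.
Definition cls n (t : term n) (g : good t) : fcell n :=
  exist _ (teq t) (ex_intro2 _ _ t g erefl).
Definition rep n (x : fcell n) : term n := s2val (cid2 (proj2_sig x)).

Lemma rep_good n (x : fcell n) : good (rep x).
Proof. by rewrite /rep; case: cid2. Qed.
Lemma rep_teq n (x : fcell n) : proj1_sig x = teq (rep x).
Proof. by rewrite /rep; case: cid2. Qed.

Definition val (C : ocat) (f : ghom A C) n (x : fcell n) : C n :=
  proj1_sig (cid (rep_good x f)).
Lemma valE (C : ocat) (f : ghom A C) n (x : fcell n) :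
  ev f (rep x) = Some (val f x).
Proof. by rewrite /val; case: cid. Qed.
Lemma val_cls (C : ocat) (f : ghom A C) n (t : term n) (g : good t) :
  ev f t = Some (val f (cls g)).
Proof.
rewrite -valE; have : teq t (rep (cls g)); last exact.
by have /= -> := rep_teq (cls g).
Qed.
Lemma val_clsE (C : ocat) (f : ghom A C) n (t : term n) (g : good t) c :
  ev f t = Some c -> val f (cls g) = c.
Proof. by rewrite (val_cls f g) => -[]. Qed.

Lemma fcell_ext n (x y : fcell n) :
  (forall (C : ocat) (f : ghom A C), val f x = val f y) -> x = y.
Proof.
move=> xy; apply: sig_ext; rewrite !rep_teq.
have e : teq (rep x) (rep y) by move=> C f; rewrite !valE xy.
by apply: funext => t; apply: propext; split=> h C f; rewrite -h e.
Qed.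

Fact good_gen n (a : A n) : good (Gen a).
Proof. by move=> C f; exists (f n a). Qed.
Fact good_src n (x : fcell n.+1) : good (Src (rep x)).
Proof. by move=> C f /=; rewrite valE /=; eexists. Qed.
Fact good_tgt n (x : fcell n.+1) : good (Tgt (rep x)).
Proof. by move=> C f /=; rewrite valE /=; eexists. Qed.
Fact good_idt n (x : fcell n) : good (Idt (rep x)).
Proof. by move=> C f /=; rewrite valE /=; eexists. Qed.

Definition fgen n (a : A n) : fcell n := cls (good_gen a).
Definition fsrc n (x : fcell n.+1) : fcell n := cls (good_src x).
Definition ftgt n (x : fcell n.+1) : fcell n := cls (good_tgt x).
Definition fidt n (x : fcell n) : fcell n.+1 := cls (good_idt x).

Lemma val_gen (C : ocat) (f : ghom A C) n (a : A n) : val f (fgen a) = f n a.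
Proof. exact: val_clsE. Qed.
Lemma val_src (C : ocat) (f : ghom A C) n (x : fcell n.+1) :
  val f (fsrc x) = src (val f x).
Proof. by apply: val_clsE; rewrite /= valE. Qed.
Lemma val_tgt (C : ocat) (f : ghom A C) n (x : fcell n.+1) :
  val f (ftgt x) = tgt (val f x).
Proof. by apply: val_clsE; rewrite /= valE. Qed.
Lemma val_idt (C : ocat) (f : ghom A C) n (x : fcell n) :
  val f (fidt x) = oid (val f x).
Proof. by apply: val_clsE; rewrite /= valE. Qed.

Fact fsrc_tgt n (x : fcell n.+2) : fsrc (fsrc x) = fsrc (ftgt x).
Proof. by apply: fcell_ext => C f; rewrite !val_src val_tgt src_tgt. Qed.
Fact ftgt_src n (x : fcell n.+2) : ftgt (fsrc x) = ftgt (ftgt x).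
Proof. by apply: fcell_ext => C f; rewrite !val_tgt val_src tgt_src. Qed.

Definition fgset : gset := @GSet fcell fsrc ftgt fsrc_tgt ftgt_src.
Definition fval (C : ocat) (f : ghom A C) : ghom fgset C :=
  @GHom fgset C (val f) (val_src f) (val_tgt f).

Lemma pcompE (C : ocat) p n (x y : C n) (h : glue p x y) :
  pcomp p x y = Some (ocomp h).
Proof.
by rewrite /pcomp; case: pselect => // h'; rewrite (Prop_irrelevance h' h).
Qed.

Fact good_cmp p n (x y : fgset n) :
  glue p x y -> good (Cmp p (rep x) (rep y)).
Proof.
move=> h C f /=; rewrite !valE /= (pcompE (glue_map (fval f) h)).
by eexists.
Qed.
Definition fcmp p n (x y : fgset n) (h : glue p x y) : fgset n :=
  cls (good_cmp h).
Lemma val_cmp (C : ocat) (f : ghom A C) p n (x y : fgset n) (h : glue p x y)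
    (a b : C n) (h' : glue p a b) :
  val f x = a -> val f y = b -> val f (fcmp h) = ocomp h'.
Proof.
by move=> xa yb; apply: val_clsE; rewrite /= !valE /= xa yb (pcompE h').
Qed.

Lemma val_idsrc (C : ocat) (f : ghom A C) p n (x : fgset n) :
  val f (@idsrc fgset fidt p n x) = idsrc (@oid C) p (val f x).
Proof.
by elim: n x => //= n IH x; rewrite val_idt -val_src; case: eqP; rewrite ?IH.
Qed.
Lemma val_idtgt (C : ocat) (f : ghom A C) p n (x : fgset n) :
  val f (@idtgt fgset fidt p n x) = idtgt (@oid C) p (val f x).
Proof.
by elim: n x => //= n IH x; rewrite val_idt -val_tgt; case: eqP; rewrite ?IH.
Qed.


Definition fcat : ocat.
Proof.
apply: (@OCat fgset fidt fcmp).
- by move=> n x; apply: fcell_ext => C f; rewrite val_src val_idt src_oid.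
- by move=> n x; apply: fcell_ext => C f; rewrite val_tgt val_idt tgt_oid.
- move=> n x y h; apply: fcell_ext => C f; have k := glue_map (fval f) h.
  by rewrite !val_src (val_cmp h k) // src_ocomp_top.
- move=> n x y h; apply: fcell_ext => C f; have k := glue_map (fval f) h.
  by rewrite !val_tgt (val_cmp h k) // tgt_ocomp_top.
- move=> p n x y h h'; apply: fcell_ext => C f.
  have k := glue_map (fval f) h; have := glue_map (fval f) h'.
  rewrite /= !val_src => k'.
  by rewrite (val_cmp h k) // (val_cmp h' k') ?val_src // (src_ocomp k k').
- move=> p n x y h h'; apply: fcell_ext => C f.
  have k := glue_map (fval f) h; have := glue_map (fval f) h'.
  rewrite /= !val_tgt => k'.
  by rewrite (val_cmp h k) // (val_cmp h' k') ?val_tgt // (tgt_ocomp k k').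
- move=> p n x y z hxy hyz hl hr; apply: fcell_ext => C f.
  have kxy := glue_map (fval f) hxy; have kyz := glue_map (fval f) hyz.
  have := glue_map (fval f) hl; have := glue_map (fval f) hr.
  rewrite /= (val_cmp hxy kxy) // (val_cmp hyz kyz) // => kr kl.
  rewrite (val_cmp hl kl) ?(val_cmp hr kr) //; first exact: ocompA.
    exact: val_cmp.
  exact: val_cmp.
- move=> p n x h; apply: fcell_ext => C f; have := glue_map (fval f) h.
  rewrite /= val_idsrc => k.
  by rewrite (val_cmp h k) ?val_idsrc // ocomp_idr.
- move=> p n x h; apply: fcell_ext => C f; have := glue_map (fval f) h.
  rewrite /= val_idtgt => k.
  by rewrite (val_cmp h k) ?val_idtgt // ocomp_idl.
- move=> p n x y h h'; apply: fcell_ext => C f.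
  have k := glue_map (fval f) h; have := glue_map (fval f) h'.
  have e z : fval f n.+1 (fidt z) = oid (val f z) by exact: val_idt.
  rewrite !e => k'.
  by rewrite (val_cmp h' k') ?val_idt // (val_cmp h k) // (ocomp_oid k).
- move=> q p n x' x y' y qp hx hy hxy hl hr hlr; apply: fcell_ext => C f.
  have kx := glue_map (fval f) hx; have ky := glue_map (fval f) hy.
  have kl := glue_map (fval f) hl; have kr := glue_map (fval f) hr.
  have := glue_map (fval f) hxy; have := glue_map (fval f) hlr.
  rewrite /= (val_cmp hx kx) // (val_cmp hy ky) // (val_cmp hl kl) //.
  rewrite (val_cmp hr kr) // => klr kxy.
  have ex : val f (fcmp hx) = ocomp kx by exact: val_cmp.
  have ey : val f (fcmp hy) = ocomp ky by exact: val_cmp.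
  have el : val f (fcmp hl) = ocomp kl by exact: val_cmp.
  have er : val f (fcmp hr) = ocomp kr by exact: val_cmp.
  rewrite (val_cmp hxy kxy ex ey) (val_cmp hlr klr el er).
  exact: interchange.
Defined.

Definition funit : ghom A fcat.
Proof.
by apply: (@GHom A fcat fgen) => n x; apply: fcell_ext => C f;
  rewrite /= ?val_src ?val_tgt !val_gen (gmap_src, gmap_tgt).
Defined.

Definition fext (C : ocat) (f : ghom A C) : ofunctor fcat C.
Proof.
apply: (@OFunctor fcat C (fval f)) => [n x|p n x y h h'] /=.
  exact: val_idt.
exact: val_cmp.
Defined.

Lemma fext_unit (C : ocat) (f : ghom A C) : gcomp (fext f) funit = f.
Proof. by apply: ghom_ext => n x /=; rewrite val_gen. Qed.

Lemma ev_nat (C D : ocat) (f : ghom A C) (g : ofunctor C D) n (t : term n) c :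
  ev f t = Some c -> ev (gcomp g f) t = Some (g _ c).
Proof.
elim: t c => {n} /= [n a|n t IH|n t IH|n t IH|p n t IHt u IHu] c.
- by case=> <-.
- by case: (ev f t) IH => //= d /(_ d erefl) -> [<-] /=; rewrite gmap_src.
- by case: (ev f t) IH => //= d /(_ d erefl) -> [<-] /=; rewrite gmap_tgt.
- by case: (ev f t) IH => //= d /(_ d erefl) -> [<-] /=; rewrite ofmap_oid.
case: (ev f t) IHt => //= d /(_ d erefl) ->.
case: (ev f u) IHu => //= e /(_ e erefl) -> /=.
rewrite {1}/pcomp; case: pselect => // k [<-].
by rewrite (pcompE (glue_map g k)) (ofmap_ocomp g k (glue_map g k)).
Qed.

Lemma val_unit n (x : fcat n) : val funit x = x.
Proof.
apply: fcell_ext => C f; have /(ev_nat (fext f)) := valE funit x.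
by rewrite fext_unit valE => -[].
Qed.

Lemma funit_uniq (C : ocat) (g h : ofunctor fcat C) :
  gcomp g funit = gcomp h funit -> g = h.
Proof.
move=> gh; apply: ofunctor_ext => n x; rewrite -(val_unit x).
have := ev_nat h (valE funit x).
by rewrite -gh (ev_nat g (valE funit x)) => -[].
Qed.

(* Opaque: only the universal property is used from here on. *)
Lemma free_ocat_exists : free_ocat A.
Proof. exact: FreeOCat fext_unit funit_uniq. Qed.
End FreeExistence.

Definition T (A : gset) : gset := fr_cat (free_ocat_exists A).

Definition eta (A : gset) : ghom A (T A) := fr_unit (free_ocat_exists A).

(* The omega-functor extending [f] along [eta]. *)
Definition Text (A : gset) (C : ocat) (f : ghom A C) :
    ofunctor (fr_cat (free_ocat_exists A)) C :=
  fr_ext (free_ocat_exists A) f.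

Definition Tmap (A B : gset) (f : ghom A B) : ghom (T A) (T B) :=
  Text (C := fr_cat (free_ocat_exists B)) (gcomp (eta B) f).

Definition mu (A : gset) : ghom (T (T A)) (T A) :=
  Text (C := fr_cat (free_ocat_exists A)) (gid (T A)).

Section MonadLaws.

Lemma Text_eta (A : gset) (C : ocat) (f : ghom A C) n (x : A n) :
  Text f _ (eta A _ x) = f _ x.
Proof.
by rewrite -[in RHS](fr_extE (free_ocat_exists A) f).
Qed.

Lemma T_uniq (A : gset) (C : ocat)
    (g h : ofunctor (fr_cat (free_ocat_exists A)) C) :
  (forall n (x : A n), g _ (eta A _ x) = h _ (eta A _ x)) ->
  forall n (x : T A n), g _ x = h _ x.
Proof.
move=> gh n x; suff -> : g = h by [].
by apply: fr_uniq; apply: ghom_ext.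
Qed.

Lemma Tmap_eta (A B : gset) (f : ghom A B) n (x : A n) :
  Tmap f _ (eta A _ x) = eta B _ (f _ x).
Proof. exact: Text_eta. Qed.

Lemma mu_eta (A : gset) n (x : T A n) : mu A _ (eta (T A) _ x) = x.
Proof. exact: (@Text_eta (T A) (fr_cat (free_ocat_exists A))). Qed.

Lemma Tmap_id (A : gset) n (x : T A n) : Tmap (gid A) _ x = x.
Proof.
apply: (T_uniq (g := Text _) (h := ofid _)) n x => n x.
by rewrite Text_eta.
Qed.

Lemma Tmap_comp (A B C : gset) (g : ghom B C) (f : ghom A B) n (x : T A n) :
  Tmap g _ (Tmap f _ x) = Tmap (gcomp g f) _ x.
Proof.
apply: (T_uniq (g := ofcomp (Text _) (Text _)) (h := Text _)) n x => n x /=.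
by rewrite !Text_eta /= ?Text_eta.
Qed.

Lemma mu_nat (A B : gset) (f : ghom A B) n (x : T (T A) n) :
  mu B _ (Tmap (Tmap f) _ x) = Tmap f _ (mu A _ x).
Proof.
apply: (T_uniq (g := ofcomp (Text _) (Text _))
               (h := ofcomp (Text _) (Text _))) n x => n x /=.
by rewrite !Text_eta /= ?Text_eta.
Qed.

Lemma mu_Teta (A : gset) n (x : T A n) : mu A _ (Tmap (eta A) _ x) = x.
Proof.
apply: (T_uniq (g := ofcomp (Text _) (Text _)) (h := ofid _)) n x => n x /=.
by rewrite !Text_eta /= ?Text_eta.
Qed.

Lemma mu_mu (A : gset) n (x : T (T (T A)) n) :
  mu A _ (Tmap (mu A) _ x) = mu A _ (mu (T A) _ x).
Proof.
apply: (T_uniq (g := ofcomp (Text _) (Text _))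
               (h := ofcomp (Text _) (Text _))) n x => n x /=.
by rewrite !Text_eta /= ?Text_eta.
Qed.

End MonadLaws.

Record coll := Coll {
  cset :> gset;
  arity : ghom cset (T gone) }.

Record chom (A B : coll) := CHom {
  cmap :> ghom A B;
  cmap_arity : forall n (x : A n), arity B _ (cmap _ x) = arity A _ x }.

Lemma chom_ext (A B : coll) (f g : chom A B) :
  (forall n (x : A n), f _ x = g _ x) -> f = g.
Proof.
case: f g => [f fa] [g ga] /= /ghom_ext fg.
by case: _ / fg in ga *; congr CHom.
Qed.

Definition coll_id (A : coll) : chom A A := @CHom A A (gid A) (fun _ _ => erefl).

Definition ccomp (A B C : coll) (g : chom B C) (f : chom A B) : chom A C.
Proof.
by apply: (@CHom A C (gcomp g f)) => n x /=; rewrite !cmap_arity.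
Defined.

Lemma ccompA (A B C D : coll) (h : chom C D) (g : chom B C) (f : chom A B) :
  ccomp (ccomp h g) f = ccomp h (ccomp g f).
Proof. exact: chom_ext. Qed.

(* A k-collection is represented by a collection with no cells of dimension
   > k.  The tensor product of two such collections, and the truncation of the
   unit, are again of this form, so that the structure of k-operad on
   [trunc k A] below is that of a monoid for the truncated tensor product. *)
Section Truncation.
Variable k : nat.

Definition tcells (A : gset) n := {_ : A n | n <= k}.
Definition tsrc (A : gset) n (x : tcells A n.+1) : tcells A n :=
  exist _ (src (proj1_sig x)) (ltnW (proj2_sig x)).
Definition ttgt (A : gset) n (x : tcells A n.+1) : tcells A n :=
  exist _ (tgt (proj1_sig x)) (ltnW (proj2_sig x)).
Definition gtrunc (A : gset) : gset.
Proof.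
apply: (@GSet (tcells A) (@tsrc A) (@ttgt A)) => n x; apply: sig_ext => /=.
  exact: src_tgt.
exact: tgt_src.
Defined.

Definition gtrunc_in (A : gset) : ghom (gtrunc A) A :=
  @GHom (gtrunc A) A (fun _ x => proj1_sig x)
    (fun _ _ => erefl) (fun _ _ => erefl).

Definition gtrunc_map (A B : gset) (f : ghom A B) :
  ghom (gtrunc A) (gtrunc B).
Proof.
apply: (@GHom (gtrunc A) (gtrunc B)
  (fun n x => exist _ (f n (proj1_sig x)) (proj2_sig x))) => n x.
  by apply: sig_ext; rewrite /= gmap_src.
by apply: sig_ext; rewrite /= gmap_tgt.
Defined.

Definition trunc (A : coll) : coll :=
  @Coll (gtrunc A) (gcomp (arity A) (gtrunc_in A)).

Definition trunc_map (A B : coll) (f : chom A B) : chom (trunc A) (trunc B).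
Proof.
by apply: (@CHom (trunc A) (trunc B) (gtrunc_map f)) => n x /=;
  exact: cmap_arity.
Defined.
End Truncation.

Section Tensor.
Variables A B : coll.

Definition tens_cells n :=
  {u : A n * T B n | arity A _ u.1 = Tmap (gbang B) _ u.2}.

Definition tens_src n (u : tens_cells n.+1) : tens_cells n.
Proof.
exists (src (proj1_sig u).1, src (proj1_sig u).2) => /=.
by rewrite !gmap_src (proj2_sig u).
Defined.

Definition tens_tgt n (u : tens_cells n.+1) : tens_cells n.
Proof.
exists (tgt (proj1_sig u).1, tgt (proj1_sig u).2) => /=.
by rewrite !gmap_tgt (proj2_sig u).
Defined.

Definition tens_gset : gset.
Proof.
apply: (@GSet tens_cells tens_src tens_tgt) => n u; apply: sig_ext => /=.
  by rewrite !src_tgt.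
by rewrite !tgt_src.
Defined.

Definition tens_fst : ghom tens_gset A :=
  @GHom tens_gset A (fun _ u => (proj1_sig u).1)
    (fun _ _ => erefl) (fun _ _ => erefl).

Definition tens_snd : ghom tens_gset (T B) :=
  @GHom tens_gset (T B) (fun _ u => (proj1_sig u).2)
    (fun _ _ => erefl) (fun _ _ => erefl).

Definition tens : coll :=
  @Coll tens_gset (gcomp (mu gone) (gcomp (Tmap (arity B)) tens_snd)).
End Tensor.

Definition tens_pair (A B : coll) n (a : A n) (x : T B n)
    (h : arity A _ a = Tmap (gbang B) _ x) : tens A B n :=
  exist _ (a, x) h.

Lemma tensP (A B : coll) n (u : tens A B n) :
  arity A _ (tens_fst A B _ u) = Tmap (gbang B) _ (tens_snd A B _ u).
Proof. exact: (proj2_sig u). Qed.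

Lemma tens_ext (A B : coll) n (u v : tens A B n) :
  tens_fst A B _ u = tens_fst A B _ v ->
  tens_snd A B _ u = tens_snd A B _ v -> u = v.
Proof.
case: u v => [[a x] p] [[b y] q] /= ab xy.
by apply: sig_ext; rewrite /= ab xy.
Qed.

Section TensorMap.
Context {A A' B B' : coll} (f : chom A A') (g : chom B B').

Fact tens_map_subproof n (u : tens A B n) :
  arity A' _ (f _ (tens_fst A B _ u)) =
  Tmap (gbang B') _ (Tmap g _ (tens_snd A B _ u)).
Proof.
by rewrite cmap_arity Tmap_comp (gone_uniq (gcomp _ _) (gbang B)) tensP.
Qed.

Definition tens_map_fun n (u : tens A B n) : tens A' B' n :=
  tens_pair (tens_map_subproof u).

Fact tens_map_src n (u : tens A B n.+1) :
  tens_map_fun (src u) = src (tens_map_fun u).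
Proof. by apply: tens_ext; rewrite /= -!gmap_src. Qed.

Fact tens_map_tgt n (u : tens A B n.+1) :
  tens_map_fun (tgt u) = tgt (tens_map_fun u).
Proof. by apply: tens_ext; rewrite /= -!gmap_tgt. Qed.

Definition tens_map_ghom : ghom (tens A B) (tens A' B') :=
  @GHom (tens A B) (tens A' B') tens_map_fun tens_map_src tens_map_tgt.

Fact tens_map_arity n (u : tens A B n) :
  arity (tens A' B') _ (tens_map_ghom _ u) = arity (tens A B) _ u.
Proof.
rewrite /= Tmap_comp; congr (mu _ _ (Tmap _ _ _)).
by apply: ghom_ext => m x /=; rewrite cmap_arity.
Qed.

Definition tens_map : chom (tens A B) (tens A' B') := CHom tens_map_arity.
End TensorMap.

Lemma tens_map_comp (A A' A'' B B' B'' : coll) (f' : chom A' A'')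
    (f : chom A A') (g' : chom B' B'') (g : chom B B') :
  ccomp (tens_map f' g') (tens_map f g) =
  tens_map (ccomp f' f) (ccomp g' g).
Proof.
by apply: chom_ext => n u; apply: tens_ext; rewrite //= Tmap_comp.
Qed.

(* The coherence maps are written in the directions that do not involve
   inverses: A (BC) -> (AB) C, A -> IA and AI -> A.  They are invertible
   because T is cartesian. *)
Section TensorAssoc.
Variables A B C : coll.
Local Notation ABC := (tens A (tens B C)).

Fact tens_assoc_subproof1 n (u : ABC n) :
  arity A _ (tens_fst _ _ _ u) =
  Tmap (gbang B) _ (Tmap (tens_fst B C) _ (tens_snd _ _ _ u)).
Proof. by rewrite Tmap_comp (gone_uniq (gcomp _ _) (gbang _)) tensP. Qed.

Definition tens_assoc_fst n (u : ABC n) : tens A B n :=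
  tens_pair (tens_assoc_subproof1 u).

Fact tens_assoc_subproof2 n (u : ABC n) :
  arity (tens A B) _ (tens_assoc_fst u) =
  Tmap (gbang C) _ (mu C _ (Tmap (tens_snd B C) _ (tens_snd _ _ _ u))).
Proof.
rewrite -mu_nat /= !Tmap_comp; congr (mu _ _ (Tmap _ _ _)).
by apply: ghom_ext => m v; exact: (tensP v).
Qed.

Definition tens_assoc_fun n (u : ABC n) : tens (tens A B) C n :=
  tens_pair (tens_assoc_subproof2 u).

Fact tens_assoc_src n (u : ABC n.+1) :
  tens_assoc_fun (src u) = src (tens_assoc_fun u).
Proof.
apply: tens_ext; last by rewrite /= -!gmap_src.
by apply: tens_ext; rewrite /= -?gmap_src.
Qed.

Fact tens_assoc_tgt n (u : ABC n.+1) :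
  tens_assoc_fun (tgt u) = tgt (tens_assoc_fun u).
Proof.
apply: tens_ext; last by rewrite /= -!gmap_tgt.
by apply: tens_ext; rewrite /= -?gmap_tgt.
Qed.

Definition tens_assoc_ghom : ghom ABC (tens (tens A B) C) :=
  @GHom ABC (tens (tens A B) C) tens_assoc_fun tens_assoc_src tens_assoc_tgt.

Fact tens_assoc_arity n (u : ABC n) :
  arity (tens (tens A B) C) _ (tens_assoc_ghom _ u) = arity ABC _ u.
Proof.
rewrite /= -mu_nat -mu_mu !Tmap_comp.
by congr (mu _ _ (Tmap _ _ _)); apply: ghom_ext.
Qed.

Definition tens_assoc : chom ABC (tens (tens A B) C) := CHom tens_assoc_arity.
End TensorAssoc.

Definition unit_coll : coll := @Coll gone (eta gone).

Section Unitors.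
Variables (k : nat) (A : coll).
Local Notation Ak := (trunc k A).
Local Notation Ik := (trunc k unit_coll).

Definition lunit_pt n (a : Ak n) : Ik n := exist _ tt (proj2_sig a).

Fact tens_lunit_subproof n (a : Ak n) :
  arity Ik _ (lunit_pt a) = Tmap (gbang Ak) _ (eta Ak _ a).
Proof. by rewrite Tmap_eta. Qed.

Definition tens_lunit_fun n (a : Ak n) : tens Ik Ak n :=
  tens_pair (tens_lunit_subproof a).

Fact tens_lunit_src n (a : Ak n.+1) :
  tens_lunit_fun (src a) = src (tens_lunit_fun a).
Proof. by apply: tens_ext; rewrite /= ?gmap_src //; apply: sig_ext. Qed.

Fact tens_lunit_tgt n (a : Ak n.+1) :
  tens_lunit_fun (tgt a) = tgt (tens_lunit_fun a).
Proof. by apply: tens_ext; rewrite /= ?gmap_tgt //; apply: sig_ext. Qed.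

Definition tens_lunit_ghom : ghom Ak (tens Ik Ak) :=
  @GHom Ak (tens Ik Ak) tens_lunit_fun tens_lunit_src tens_lunit_tgt.

Fact tens_lunit_arity n (a : Ak n) :
  arity (tens Ik Ak) _ (tens_lunit_ghom _ a) = arity Ak _ a.
Proof. by rewrite /= Tmap_eta mu_eta. Qed.

Definition tens_lunit : chom Ak (tens Ik Ak) := CHom tens_lunit_arity.

Fact tens_runit_arity n (u : tens Ak Ik n) :
  arity Ak _ (tens_fst Ak Ik _ u) = arity (tens Ak Ik) _ u.
Proof.
rewrite tensP [RHS]/= -Tmap_comp mu_Teta.
by rewrite (gone_uniq (gtrunc_in k gone) (gbang Ik)).
Qed.

Definition tens_runit : chom (tens Ak Ik) Ak :=
  @CHom (tens Ak Ik) Ak (tens_fst Ak Ik) tens_runit_arity.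
End Unitors.

Record operad_str (k : nat) (A : coll) := OperadStr {
  omul : chom (tens (trunc k A) (trunc k A)) (trunc k A);
  ounit : chom (trunc k unit_coll) (trunc k A);
  omulA :
    ccomp omul (ccomp (tens_map omul (coll_id (trunc k A)))
                      (tens_assoc (trunc k A) (trunc k A) (trunc k A))) =
    ccomp omul (tens_map (coll_id (trunc k A)) omul);
  omul_unitl :
    ccomp omul (ccomp (tens_map ounit (coll_id (trunc k A))) (tens_lunit k A)) =
    coll_id (trunc k A);
  omul_unitr :
    ccomp omul (tens_map (coll_id (trunc k A)) ounit) = tens_runit k A }.

Definition preserves_operad k (A B : coll)
    (P : operad_str k A) (Q : operad_str k B) (f : chom A B) : Prop :=
  ccomp (trunc_map k f) (omul P) =
    ccomp (omul Q) (tens_map (trunc_map k f) (trunc_map k f)) /\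
  ccomp (trunc_map k f) (ounit P) = ounit Q.

(* Only cells of dimension <= k of [A] are involved, so this is a k-contraction
   on the underlying k-collection of [A]. *)
Record contraction (k : nat) (A : coll) := Contraction {
  gam : forall m, m < k -> forall (a b : A m), parallel a b ->
    forall theta : T gone m.+1,
    src theta = arity A _ a -> tgt theta = arity A _ b -> A m.+1;
  src_gam : forall m (h : m < k) (a b : A m) (p : parallel a b)
    (theta : T gone m.+1) (hs : src theta = arity A _ a)
    (ht : tgt theta = arity A _ b), src (gam h p hs ht) = a;
  tgt_gam : forall m (h : m < k) (a b : A m) (p : parallel a b)
    (theta : T gone m.+1) (hs : src theta = arity A _ a)
    (ht : tgt theta = arity A _ b), tgt (gam h p hs ht) = b;
  arity_gam : forall m (h : m < k) (a b : A m) (p : parallel a b)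
    (theta : T gone m.+1) (hs : src theta = arity A _ a)
    (ht : tgt theta = arity A _ b), arity A _ (gam h p hs ht) = theta }.
Arguments gam {k A} _ {m} h {a b} p {theta} hs ht.

Lemma gam_irr k A (c : contraction k A) m (h h' : m < k) (a b : A m)
    (p p' : parallel a b) (theta : T gone m.+1)
    (hs hs' : src theta = arity A _ a) (ht ht' : tgt theta = arity A _ b) :
  gam c h p hs ht = gam c h' p' hs' ht'.
Proof.
by rewrite (Prop_irrelevance h h') (Prop_irrelevance p p')
  (Prop_irrelevance hs hs') (Prop_irrelevance ht ht').
Qed.

Definition preserves_contraction k (A B : coll)
    (c : contraction k A) (c' : contraction k B) (f : chom A B) : Prop :=
  forall m (h : m < k) (a b : A m) (p : parallel a b)
    (theta : T gone m.+1) (hs : src theta = arity A _ a)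
    (ht : tgt theta = arity A _ b) (p' : parallel (f _ a) (f _ b))
    (hs' : src theta = arity B _ (f _ a))
    (ht' : tgt theta = arity B _ (f _ b)),
  f _ (gam c h p hs ht) = gam c' h p' hs' ht'.

Definition restrict_contraction k (A : coll) (c : contraction k.+1 A) :
  contraction k A :=
  @Contraction k A
    (fun m h a b p theta hs ht => gam c (leqW h) p hs ht)
    (fun m h a b p theta hs ht => src_gam c (leqW h) p hs ht)
    (fun m h a b p theta hs ht => tgt_gam c (leqW h) p hs ht)
    (fun m h a b p theta hs ht => arity_gam c (leqW h) p hs ht).

Record contr_ob (k : nat) := ContrOb {
  ccoll :> coll;
  cstr : contraction k ccoll }.
Arguments cstr {k} _.

Record contr_hom k (X Y : contr_ob k) := ContrHom {
  chom_of :> chom X Y;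
  chom_ofP : preserves_contraction (cstr X) (cstr Y) chom_of }.
Arguments chom_ofP {k X Y} _.

Lemma contr_hom_ext k (X Y : contr_ob k) (f g : contr_hom X Y) :
  (forall n (x : X n), f _ x = g _ x) -> f = g.
Proof.
case: f g => [f fP] [g gP] /= /chom_ext fg.
by case: _ / fg in gP *; congr ContrHom.
Qed.

Fact contr_idP k (X : contr_ob k) :
  preserves_contraction (cstr X) (cstr X) (coll_id X).
Proof.
by move=> m h a b p theta hs ht p' hs' ht'; exact: gam_irr.
Qed.

Lemma parallel_map (A B : gset) (f : ghom A B) n (a b : A n) :
  parallel a b -> parallel (f _ a) (f _ b).
Proof.
case: n a b => //= n a b [ab1 ab2].
by rewrite -!gmap_src -!gmap_tgt ab1 ab2.
Qed.

Fact contr_compP k (X Y Z : contr_ob k)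
    (g : contr_hom Y Z) (f : contr_hom X Y) :
  preserves_contraction (cstr X) (cstr Z) (ccomp g f).
Proof.
move=> m h a b p theta hs ht p' hs' ht' /=.
have hs1 : src theta = arity Y _ (f _ a) by rewrite cmap_arity.
have ht1 : tgt theta = arity Y _ (f _ b) by rewrite cmap_arity.
rewrite (chom_ofP f m h a b p theta hs ht (parallel_map f p) hs1 ht1).
exact: (chom_ofP g).
Qed.

Arguments contr_idP {k} X.
Arguments contr_compP {k X Y Z} g f.

Definition contr_id k (X : contr_ob k) : contr_hom X X :=
  ContrHom (contr_idP X).
Definition contr_comp k (X Y Z : contr_ob k)
    (g : contr_hom Y Z) (f : contr_hom X Y) : contr_hom X Z :=
  ContrHom (contr_compP g f).

Definition Contr (k : nat) : category.
Proof.
by apply: (@Category (contr_ob k) (@contr_hom k) (@contr_id k)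
  (@contr_comp k)) => *; apply: contr_hom_ext.
Defined.

Record owc_ob (i j : nat) := OwcOb {
  owc_contr :> contr_ob i;
  owc_op : operad_str j owc_contr }.
Arguments owc_op {i j} _.

Record owc_hom i j (X Y : owc_ob i j) := OwcHom {
  owc_chom :> contr_hom X Y;
  owc_chomP : preserves_operad (owc_op X) (owc_op Y) owc_chom }.
Arguments owc_chomP {i j X Y} _.

Lemma owc_hom_ext i j (X Y : owc_ob i j) (f g : owc_hom X Y) :
  (forall n (x : X n), f _ x = g _ x) -> f = g.
Proof.
case: f g => [f fP] [g gP] /= /contr_hom_ext fg.
by case: _ / fg in gP *; congr OwcHom.
Qed.

Fact owc_idP i j (X : owc_ob i j) :
  preserves_operad (owc_op X) (owc_op X) (contr_id X).
Proof.
have idE : trunc_map j (coll_id X) = coll_id (trunc j X).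
  by apply: chom_ext => n x; apply: sig_ext.
split; rewrite /= idE; last by apply: chom_ext.
apply: chom_ext => n u /=; congr (omul _ _ _).
by apply: tens_ext; rewrite //= Tmap_id.
Qed.

Fact owc_compP i j (X Y Z : owc_ob i j) (g : owc_hom Y Z) (f : owc_hom X Y) :
  preserves_operad (owc_op X) (owc_op Z) (contr_comp g f).
Proof.
have cE : trunc_map j (contr_comp g f) =
    ccomp (trunc_map j g) (trunc_map j f).
  by apply: chom_ext => n x; apply: sig_ext.
have [[fm fu] [gm gu]] := (owc_chomP f, owc_chomP g).
rewrite /preserves_operad cE; split; rewrite ccompA; last by rewrite fu gu.
by rewrite fm -ccompA gm ccompA tens_map_comp.
Qed.

Definition owc_id i j (X : owc_ob i j) : owc_hom X X :=
  OwcHom (@owc_idP i j X).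
Definition owc_comp i j (X Y Z : owc_ob i j)
    (g : owc_hom Y Z) (f : owc_hom X Y) : owc_hom X Z :=
  OwcHom (owc_compP g f).

Definition OWC (i j : nat) : category.
Proof.
by apply: (@Category (owc_ob i j) (@owc_hom i j) (@owc_id i j)
  (@owc_comp i j)) => *; apply: owc_hom_ext.
Defined.

Definition U (i j : nat) : functor (OWC i j) (Contr i) :=
  @Functor (OWC i j) (Contr i) (@owc_contr i j) (fun X Y f => owc_chom f)
    (fun _ => erefl) (fun _ _ _ _ _ => erefl).

Definition K_ob k (X : contr_ob k.+1) : contr_ob k :=
  ContrOb (restrict_contraction (cstr X)).
Definition K_hom k (X Y : contr_ob k.+1) (f : contr_hom X Y) :
  contr_hom (K_ob X) (K_ob Y) :=
  @ContrHom k (K_ob X) (K_ob Y) f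
    (fun m h => chom_ofP f m (leqW h)).

Definition K (k : nat) : functor (Contr k.+1) (Contr k).
Proof.
by apply: (@Functor (Contr k.+1) (Contr k) (@K_ob k) (@K_hom k)) => *;
  apply: contr_hom_ext.
Defined.

Definition G_ob k j (X : owc_ob k.+1 j) : owc_ob k j :=
  @OwcOb k j (K_ob X) (owc_op X).
Definition G_hom k j (X Y : owc_ob k.+1 j) (f : owc_hom X Y) :
  owc_hom (G_ob X) (G_ob Y) :=
  @OwcHom k j (G_ob X) (G_ob Y) (K_hom f) (owc_chomP f).

Definition G (k j : nat) : functor (OWC k.+1 j) (OWC k j).
Proof.
by apply: (@Functor (OWC k.+1 j) (OWC k j) (@G_ob k j) (@G_hom k j)) => *;
  apply: owc_hom_ext.
Defined.

(* In every dimension other than k+1 the unit of the adjunction is literally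
   an identity map.  As the unit is a morphism of Contr_k, it follows that the
   sources, targets, arities and k-contraction of [H X] are those of [X] away
   from dimension k+1. *)
Definition unchanged_off k (H : functor (Contr k) (Contr k.+1))
    (HK : adjunction H (K k)) : Prop :=
  forall (X : contr_ob k) (n : nat), n != k.+1 ->
    existT (fun S : Type => X n -> S) (H X n)
      (fun x => (unit HK X : contr_hom X (K_ob (H X))) n x) =
    existT (fun S : Type => X n -> S) (X n) (fun x => x).

(* [L' -| R'] lifts [L -| R] along [V] and [W]: both squares commute strictly
   and the unit of [L' -| R'] lies over that of [L -| R] (equivalently, the
   counits, or the hom-set bijections, correspond).  The two units are compared
   as morphisms out of [W X] with codomains [W (R' (L' X))] and
   [R (L (W X))], which agree once the squares commute. *)
Definition lifts (C D C' D' : category)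
    (L : functor C D) (R : functor D C) (LR : adjunction L R)
    (L' : functor C' D') (R' : functor D' C') (LR' : adjunction L' R')
    (V : functor D' D) (W : functor C' C) : Prop :=
  [/\ fcomp W R' = fcomp R V,
      fcomp V L' = fcomp L W
    & forall X : C',
        existT (fun Y : C => hom (W X) Y) (W (R' (L' X)))
          (fmap W (unit LR' X)) =
        existT (fun Y : C => hom (W X) Y) (R (L (W X))) (unit LR (W X))].

(* Main.v *)
Require Import Defs.
From mathcomp Require Import all_boot boolp.

(** In dimensions at most k the unit X -> K (H X) is an identity, so it is an
    isomorphism of underlying k-collections.  A k-operad structure lives on the
    underlying k-collection only; hence it moves along the unit from X to H X
    ([operad_transport]), and this gives F on objects.

    The unit then becomes an opcartesian arrow for the functor that forgets
    operad structures: a map g out of H X preserves them as soon as the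
    composite of g with the unit does ([preserves_operad_cancel]).  Two
    instances yield the whole adjunction.  For g = H f the composite is, by
    naturality, f followed by the unit of its codomain, so F is defined on
    morphisms; for g a counit the composite is an identity, by a triangle
    identity, so the counit lifts as well.  Since maps in OWC are maps in Contr
    with a property, all the remaining equations are those already satisfied by
    H -| K; and since F and G act on the underlying objects and maps as H and K
    do, both squares commute strictly. *)

Set Implicit Arguments.
Unset Strict Implicit.
Unset Printing Implicit Defensive.

Lemma ccomp_idl (A B : coll) (f : chom A B) : ccomp (coll_id B) f = f.
Proof. exact: chom_ext. Qed.

Lemma ccomp_idr (A B : coll) (f : chom A B) : ccomp f (coll_id A) = f.
Proof. exact: chom_ext. Qed.

Definition coll_iso (A B : coll) (f : chom A B) : Prop :=
  exists2 j : chom B A, ccomp j f = coll_id A & ccomp f j = coll_id B.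

(** The pointwise inverse commutes with sources, targets and arities because
    it can be cancelled against the map itself, which does. *)
Lemma bijective_coll_iso (A B : coll) (f : chom A B) :
  (forall n, bijective (f n)) -> coll_iso f.
Proof.
move=> bf.
have inv n : {g : B n -> A n | cancel (f n) g /\ cancel g (f n)}.
  by apply: cid; case: (bf n) => g; exists g.
pose j n := proj1_sig (inv n).
have fK n : cancel (f n) (j n) by case: (proj2_sig (inv n)).
have jK n : cancel (j n) (f n) by case: (proj2_sig (inv n)).
have js n (x : B n.+1) : j n (src x) = src (j n.+1 x).
  by apply: (can_inj (fK n)); rewrite jK gmap_src jK.
have jt n (x : B n.+1) : j n (tgt x) = tgt (j n.+1 x).
  by apply: (can_inj (fK n)); rewrite jK gmap_tgt jK.
have ja n (x : B n) : arity A _ (j n x) = arity B _ x.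
  by rewrite -(cmap_arity f) jK.
by exists (@CHom B A (@GHom B A j js jt) ja);
  apply: chom_ext => n x /=; rewrite (fK, jK).
Qed.

Lemma trunc_map_iso k (A B : coll) (f : chom A B) :
  (forall n, n <= k -> bijective (f n)) -> coll_iso (trunc_map k f).
Proof.
move=> bf; apply: bijective_coll_iso => n.
have [nk|kn] := leqP n k.
  have [g fK gK] := bf n nk.
  by exists (fun x : trunc k B n =>
      exist _ (g (proj1_sig x)) (proj2_sig x) : trunc k A n) => x;
    apply: sig_ext; rewrite /= (fK, gK).
have empty (C : coll) : trunc k C n -> False.
  by case=> x /=; rewrite leqNgt kn.
by exists (fun x => False_rect _ (empty B x)) => x; case: (empty _ x).
Qed.

Lemma trunc_map_comp k (A B C : coll) (g : chom B C) (f : chom A B) :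
  trunc_map k (ccomp g f) = ccomp (trunc_map k g) (trunc_map k f).
Proof. by apply: chom_ext => n x; apply: sig_ext. Qed.

Lemma tens_map_id (A B : coll) :
  tens_map (coll_id A) (coll_id B) = coll_id (tens A B).
Proof. by apply: chom_ext => n u; apply: tens_ext; rewrite //= Tmap_id. Qed.

Lemma tens_assoc_nat (A A' B B' C C' : coll)
    (f : chom A A') (g : chom B B') (h : chom C C') :
  ccomp (tens_map (tens_map f g) h) (tens_assoc A B C) =
  ccomp (tens_assoc A' B' C') (tens_map f (tens_map g h)).
Proof.
apply: chom_ext => n u; apply: tens_ext; last first.
  by rewrite /= -mu_nat !Tmap_comp; congr (mu _ _ (Tmap _ _ _)); apply: ghom_ext.
apply: tens_ext => //=; rewrite !Tmap_comp.
rewrite (_ : gcomp g _ = gcomp (tens_fst B' C') (tens_map_ghom g h)) //.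
exact: ghom_ext.
Qed.

Lemma tens_lunit_nat k (A B : coll) (f : chom (trunc k A) (trunc k B)) :
  ccomp (tens_map (coll_id _) f) (tens_lunit k A) = ccomp (tens_lunit k B) f.
Proof.
apply: chom_ext => n a; apply: tens_ext; last by rewrite /= Tmap_eta.
exact: sig_ext.
Qed.

Lemma tens_runit_nat k (A B : coll) (f : chom (trunc k A) (trunc k B)) :
  ccomp (tens_runit k B) (tens_map f (coll_id _)) = ccomp f (tens_runit k A).
Proof. exact: chom_ext. Qed.

Section Transport.
Variables (k : nat) (A B : coll) (P : operad_str k A).
Variables (i : chom (trunc k A) (trunc k B)) (j : chom (trunc k B) (trunc k A)).
Hypotheses (ji : ccomp j i = coll_id _) (ij : ccomp i j = coll_id _).

Let mulB := ccomp i (ccomp (omul P) (tens_map j j)).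
Let unitB := ccomp i (ounit P).

(** Conjugating by an isomorphism: each law reduces to the one of [P] once the
    inner factors [j i] cancel and the outer [j] slides past the coherence
    map. *)
Fact transport_mulA :
  ccomp mulB (ccomp (tens_map mulB (coll_id _)) (tens_assoc _ _ _)) =
  ccomp mulB (tens_map (coll_id _) mulB).
Proof.
have jmul : ccomp j mulB = ccomp (omul P) (tens_map j j).
  by rewrite /mulB -ccompA ji ccomp_idl.
rewrite {1 3}/mulB !ccompA; congr (ccomp i _).
rewrite -(ccompA (tens_map j j)) !tens_map_comp jmul !ccomp_idr.
have splitl : tens_map (ccomp (omul P) (tens_map j j)) j =
    ccomp (tens_map (omul P) (coll_id _)) (tens_map (tens_map j j) j).
  by rewrite tens_map_comp ccomp_idl.
have splitr : tens_map j (ccomp (omul P) (tens_map j j)) =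
    ccomp (tens_map (coll_id _) (omul P)) (tens_map j (tens_map j j)).
  by rewrite tens_map_comp ccomp_idl.
by rewrite splitl splitr ccompA tens_assoc_nat -!ccompA -omulA !ccompA.
Qed.

Fact transport_unitl :
  ccomp mulB (ccomp (tens_map unitB (coll_id _)) (tens_lunit k B)) =
  coll_id (trunc k B).
Proof.
have ju : ccomp j unitB = ounit P by rewrite -ccompA ji ccomp_idl.
rewrite /mulB !ccompA -(ccompA (tens_map j j)) tens_map_comp ju ccomp_idr.
have split : tens_map (ounit P) j =
    ccomp (tens_map (ounit P) (coll_id _)) (tens_map (coll_id _) j).
  by rewrite tens_map_comp ccomp_idl ccomp_idr.
rewrite split ccompA tens_lunit_nat -(ccompA (tens_map (ounit P) _)).
by rewrite -(ccompA (omul P)) omul_unitl ccomp_idl.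
Qed.

Fact transport_unitr :
  ccomp mulB (tens_map (coll_id _) unitB) = tens_runit k B.
Proof.
have ju : ccomp j unitB = ounit P by rewrite -ccompA ji ccomp_idl.
rewrite /mulB !ccompA tens_map_comp ju ccomp_idr.
have split : tens_map j (ounit P) =
    ccomp (tens_map (coll_id _) (ounit P)) (tens_map j (coll_id _)).
  by rewrite tens_map_comp ccomp_idl ccomp_idr.
rewrite split -(ccompA (omul P)) omul_unitr tens_runit_nat -ccompA ij.
exact: ccomp_idl.
Qed.

Definition transport : operad_str k B :=
  OperadStr transport_mulA transport_unitl transport_unitr.
End Transport.

Lemma operad_transport k (A B : coll) (f : chom A B) (P : operad_str k A) :
  coll_iso (trunc_map k f) -> exists Q : operad_str k B, preserves_operad P Q f.
Proof.
case=> j jf fj; exists (transport P jf fj); split=> //=.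
by rewrite !ccompA tens_map_comp jf tens_map_id ccomp_idr.
Qed.

(** As [f] is invertible on k-collections, so is its tensor square; the
    equation to prove for [g] may therefore be precomposed with it. *)
Lemma preserves_operad_cancel k (A B C : coll) (P : operad_str k A)
    (Q : operad_str k B) (R : operad_str k C) (f : chom A B) (g : chom B C) :
  coll_iso (trunc_map k f) -> preserves_operad P Q f ->
  preserves_operad P R (ccomp g f) -> preserves_operad Q R g.
Proof.
case=> j _ fj [fm fu]; rewrite /preserves_operad trunc_map_comp => -[gfm gfu].
split; last by rewrite -fu -ccompA.
have epi : ccomp (tens_map (trunc_map k f) (trunc_map k f)) (tens_map j j) =
    coll_id _ by rewrite tens_map_comp fj tens_map_id.
rewrite -[LHS]ccomp_idr -[RHS]ccomp_idr -epi -!ccompA; congr (ccomp _ _).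
by rewrite ccompA -fm -ccompA gfm ccompA tens_map_comp.
Qed.

Lemma functor_eq (C D : category) (fo : C -> D)
    (fm : forall X Y, hom X Y -> hom (fo X) (fo Y)) i i' c c' :
  @Functor C D fo fm i c = @Functor C D fo fm i' c'.
Proof. by congr Functor; apply: Prop_irrelevance. Qed.

Section Lift.
Variables (k : nat) (H : functor (Contr k) (Contr k.+1)).
Variable HK : adjunction H (K k).
Hypothesis Hoff : unchanged_off HK.

Let eps (Y : contr_ob k.+1) : contr_hom (H (K_ob Y)) Y := counit HK Y.
Let eta1 (X : contr_ob k) : contr_hom X (K_ob (H X)) := unit HK X.

Lemma unit_iso X : coll_iso (trunc_map k (eta1 X)).
Proof.
apply: trunc_map_iso => n nk.
have ne : n != k.+1 by rewrite neq_ltn ltnS nk.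
(* Generalizing the whole pair lets the equality of types be eliminated. *)
have bij (p : {S : Type & X n -> S}) :
    p = existT (fun S : Type => X n -> S) (X n : Type) (fun x => x) ->
    bijective (projT2 p).
  by move=> ->; exists id.
exact: bij (Hoff X ne).
Qed.

Let F_op (X : owc_ob k k) :=
  cid (operad_transport (owc_op X) (unit_iso X)).

Definition F_ob (X : owc_ob k k) : owc_ob k.+1 k :=
  @OwcOb k.+1 k (H X) (proj1_sig (F_op X)).

Definition F_unit (X : owc_ob k k) : owc_hom X (G_ob (F_ob X)) :=
  @OwcHom k k X (G_ob (F_ob X)) (eta1 X) (proj2_sig (F_op X)).

Fact F_homP (X Y : owc_ob k k) (f : owc_hom X Y) :
  preserves_operad (owc_op (F_ob X)) (owc_op (F_ob Y))
    (fmap H (f : hom (X : Contr k) Y) : contr_hom (H X) (H Y)).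
Proof.
apply: (preserves_operad_cancel (unit_iso X) (owc_chomP (F_unit X))).
have := owc_chomP (owc_comp (F_unit Y) f); rewrite /=.
have := unit_nat HK (f : hom (X : Contr k) Y).
by move/(congr1 (fun h : contr_hom X (K_ob (H Y)) => h : chom X (H Y))) => /= ->.
Qed.

Definition F_hom (X Y : owc_ob k k) (f : owc_hom X Y) :
  owc_hom (F_ob X) (F_ob Y) := OwcHom (F_homP f).

Fact F_counitP (Y : owc_ob k.+1 k) :
  preserves_operad (owc_op (F_ob (G_ob Y))) (owc_op Y) (eps Y).
Proof.
apply: (preserves_operad_cancel (unit_iso (K_ob Y))
  (owc_chomP (F_unit (G_ob Y)))).
have := owc_chomP (owc_id (G_ob Y)); rewrite /=.
have := triangleR HK (Y : contr_ob k.+1).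
by move/(congr1 (fun h : contr_hom (K_ob Y) (K_ob Y) => h : chom Y Y)) => /= ->.
Qed.

Definition F_counit (Y : owc_ob k.+1 k) : owc_hom (F_ob (G_ob Y)) Y :=
  OwcHom (F_counitP Y).

Lemma U_faithful i j (X Y : owc_ob i j) (f g : owc_hom X Y) :
  owc_chom f = owc_chom g -> f = g.
Proof. by move=> fg; apply: owc_hom_ext; rewrite fg. Qed.

Definition F : functor (OWC k k) (OWC k.+1 k).
Proof.
apply: (@Functor (OWC k k) (OWC k.+1 k) F_ob F_hom) => [X|X Y Z g f];
  apply: U_faithful.
- exact: (fmap_id H).
- exact: (fmap_cmp H).
Defined.

Definition FG : adjunction F (G k k).
Proof.
apply: (@Adjunction (OWC k k) (OWC k.+1 k) F (G k k) F_unit F_counit)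
  => [X Y f|X Y g|X|Y]; apply: U_faithful.
- exact: (unit_nat HK).
- exact: (counit_nat HK).
- exact: (triangleL HK).
- exact: (triangleR HK).
Defined.

Lemma FG_lifts : lifts HK FG (U k.+1 k) (U k k).
Proof. by split=> //; exact: functor_eq. Qed.
End Lift.

Theorem lemma2p3 (k : nat)
    (H : functor (Contr k) (Contr k.+1)) (HK : adjunction H (K k))
    (Hoff : unchanged_off HK) :
  exists (F : functor (OWC k k) (OWC k.+1 k)) (FG : adjunction F (G k k)),
    lifts HK FG (U k.+1 k) (U k k).
Proof. by exists (F Hoff), (FG Hoff); exact: FG_lifts. Qed.
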